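(* Let $\overline{\mathbb{D}}$ be the closed unit disk in $\mathbb{C}$; let $$K_2=\{z\in\overline{\mathbb{D}}:|z-(-1+i)|\le1\},\qquad K_j=-i\,K_{j-1}\ \text{ for }j=3,4,5,$$ and let $K_1$ be the closure of $\overline{\mathbb{D}}\setminus(K_2\cup K_3\cup K_4\cup K_5)$. Writing $B(c,r)$ for the open disk of radius $r$ centered at $c$ and $\overline{\mathbb{C}}=\mathbb{C}\cup\{\infty\}$, define $$L_1=\overline{\mathbb{C}}\setminus\Big(B(\tfrac{1+i}{2},\tfrac1{\sqrt2})\cup B(\tfrac{-1+i}{2},\tfrac1{\sqrt2})\cup B(\tfrac{-1-i}{2},\tfrac1{\sqrt2})\cup B(\tfrac{1-i}{2},\tfrac1{\sqrt2})\Big),$$ $$L_2=L_1\setminus\{w\in\mathbb{C}:\operatorname{Im}w>\operatorname{Re}w+1\},\qquad L_j=-i\,L_{j-1}\ \text{ for }j=3,4,5.$$ Then the map $\hat G$ for the disk algorithm is bijective a.e. on $\bigcup_{j=1}^5K_j\times L_j$.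
   Context: Here $i=\sqrt{-1}$ and $\alpha=1+i$. Define subsets of the closed unit disk: $V_0=\overline{\mathbb{D}}$; $V_1=\{w\in\overline{\mathbb{D}}:|w+\alpha|\ge1\}$; $V_j=-i\,V_{j-1}$ for $j=2,3,4$; $V_5=V_1\cap V_2$; $V_j=-i\,V_{j-1}$ for $j=6,7,8$. Let $E=\{x+yi\in\mathbb{Z}[i]:x+y\text{ even}\}$, partitioned into $E_0=\{0\}$; $E_1=\{n\alpha:n>0\}$; $E_j=-i\,E_{j-1}$ for $j=2,3,4$; $E_5=\{n\alpha+m\overline{\alpha}:n,m>0\}$; $E_j=-i\,E_{j-1}$ for $j=6,7,8$ ($n,m$ integers). For $a\in E$ let $V(a)=V_j$ where $a\in E_j$. The disk algorithm is the choice function with $\lfloor w\rceil=a\in E$ if $w\in a+V(a)$ (with any convention on the null set of boundary points lying in several of these sets); its fundamental set is $K=\overline{\mathbb{D}}$. Its natural extension map is $\hat G(z,w)=(-1/z-a,\,-1/w-a)$ with $a=\lfloor-1/z\rceil$, for $z\in K\setminus\{0\}$ and $w$ in the Riemann sphere. ''Bijective a.e. on $\Omega$'' means that, after removing sets of zero Lebesgue measure (in $\mathbb{C}^2$) from the source and from the target, $\hat G$ restricts to a bijection of $\Omega$ onto $\Omega$. *)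

(* Defs.v *)
From HB Require Import structures.
From mathcomp Require Import all_boot all_order all_algebra.
From mathcomp Require Import complex.
From mathcomp Require Import all_classical all_reals all_analysis.
Set Implicit Arguments.
Unset Strict Implicit.
Unset Printing Implicit Defensive.
Import Order.TTheory GRing.Theory Num.Theory.
Import numFieldNormedType.Exports.
Local Open Scope classical_set_scope.
Local Open Scope complex_scope.
Local Open Scope ring_scope.

(* [None] is the point at infinity. *)
Notation sphere R := (one_point_compactification R[i]).

Section DiskAlgorithm.
Variable R : realType.
Local Notation C := R[i].
Local Notation "''i'" := ('i%C : R[i]).

Definition alpha : C := 1 + 'i.

Definition turn (A : set C) : set C := [set - 'i * w | w in A].

Definition disk : set C := [set w | `|w| <= 1].

Definition V1 : set C := [set w | disk w /\ 1 <= `|w + alpha|].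

(* Meaningful for j <= 8. *)
Fixpoint V (j : nat) : set C :=
  match j with
  | 0 => disk
  | 1 => V1
  | 5 => V1 `&` turn V1
  | k.+1 => turn (V k)
  end.

Definition E : set C :=
  [set a | exists x y : int,
    (2 %| x + y)%Z /\ a = x%:~R + y%:~R * 'i].

(* Meaningful for j <= 8. *)
Fixpoint Epart (j : nat) : set C :=
  match j with
  | 0 => [set 0]
  | 1 => [set a | exists n : nat, (0 < n)%N /\ a = n%:R * alpha]
  | 5 => [set a | exists n m : nat,
           [/\ (0 < n)%N, (0 < m)%N & a = n%:R * alpha + m%:R * alpha^*]]
  | k.+1 => turn (Epart k)
  end.

(* V(a) = V_j for the index j such that a lies in E_j. *)
Definition Vof (a : C) : set C :=
  [set w | exists j : nat, [/\ (j <= 8)%N, Epart j a & V j w]].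

(* A point lying in several sets a + V(a) may be sent to any of these a. *)
Definition disk_algorithm (fl : C -> C) : Prop :=
  forall w, E (fl w) /\ Vof (fl w) (w - fl w).

Definition sphere_oppinv (w : sphere R) : sphere R :=
  match w with
  | None => Some 0
  | Some u => if u == 0 then None else Some (- u^-1)
  end.

Definition sphere_sub (w : sphere R) (a : C) : sphere R :=
  match w with
  | None => None
  | Some u => Some (u - a)
  end.

(* Only meaningful on [Ghat_dom]. *)
Definition Ghat (fl : C -> C) (p : C * sphere R) : C * sphere R :=
  let a := fl (- p.1^-1) in
  (- p.1^-1 - a, sphere_sub (sphere_oppinv p.2) a).

Definition Ghat_dom : set (C * sphere R) :=
  [set p | disk p.1 /\ p.1 != 0].

Local Notation lebesgue2 :=
  (@lebesgue_measure R \x @lebesgue_measure R)%E.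

(* Lebesgue-null subsets of C^2 = R^4; the points with w = oo carry no mass. *)
Definition null_C2 (N : set (C * sphere R)) : Prop :=
  (lebesgue2 \x lebesgue2)%E.-negligible
    [set q : (R * R) * (R * R) |
      N (q.1.1 +i* q.1.2, Some (q.2.1 +i* q.2.2))].

Definition bijective_ae (D Omega : set (C * sphere R))
    (f : C * sphere R -> C * sphere R) : Prop :=
  exists N1 N2 : set (C * sphere R),
    [/\ null_C2 N1, null_C2 N2, Omega `\` N1 `<=` D &
        set_bij (Omega `\` N1) (Omega `\` N2) f].

Definition K2 : set C := [set z | disk z /\ `|z - (- 1 + 'i)| <= 1].
Definition K3 := turn K2.
Definition K4 := turn K3.
Definition K5 := turn K4.
(* [C^o] carries the topology of the norm of C. *)
Definition K1 : set C :=
  closure (disk `\` (K2 `|` K3 `|` K4 `|` K5) : set C^o).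

Definition turnS (A : set (sphere R)) : set (sphere R) :=
  [set omap (fun u => - 'i * u) w | w in A].

Definition B (c : C) (r : R) : set C := @ball C C^o c r%:C.

Definition L1 : set (sphere R) :=
  let r := (Num.sqrt 2)^-1 in
  ~` (Some @` (B ((1 + 'i) / 2) r `|` B ((- 1 + 'i) / 2) r
               `|` B ((- 1 - 'i) / 2) r `|` B ((1 - 'i) / 2) r)).
Definition L2 : set (sphere R) :=
  L1 `\` (Some @` [set w : C | complex.Re w + 1 < complex.Im w]).
Definition L3 := turnS L2.
Definition L4 := turnS L3.
Definition L5 := turnS L4.

Definition Omega : set (C * sphere R) :=
  (K1 `*` L1) `|` (K2 `*` L2) `|` (K3 `*` L3) `|` (K4 `*` L4) `|` (K5 `*` L5).

End DiskAlgorithm.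

(* Main.v *)
Require Import Defs.
From mathcomp Require Import all_boot all_order all_algebra.
From mathcomp Require Import complex.
From mathcomp Require Import all_classical all_reals all_analysis.
From mathcomp Require Import measurable_realfun.
From mathcomp Require Import zify ring lra.
Set Implicit Arguments.
Unset Strict Implicit.
Unset Printing Implicit Defensive.
Import Order.TTheory GRing.Theory Num.Theory.
Import numFieldNormedType.Exports.
Local Open Scope classical_set_scope.
Local Open Scope ring_scope.

(* Put u = -1/z and v = -1/w.  The inversion turns L1 into the closed square Q
   with vertices 1, i, -1, -i, and the translates Q + a, a in E, tile the plane;
   it turns the half-plane removed from L_j (j >= 2) into the disk on a side of
   Q as diameter, and K_j into the cell a + V(a) of one of the four shortest
   a in E.  For generic (z', w') let -a be the centre of the tile containing w'.
   Then (z', w') lies in Omega iff z' lies in V(a) and (z' + a, w' + a) lies in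
   the inverted Omega: the half-plane condition on w' says that V(a) has not
   been cut near z', and the four disks removed in L1 are filled, inside their
   two tiles, by the missing tile a = 0 and by the disks removed from the four
   adjacent tiles.  As cells and tiles are pairwise disjoint up to their
   boundaries, Ghat is a bijection off the boundaries, a countable union of
   lines and circles. *)

(** * The tiling in real coordinates *)

Section Real.
Variable R : realType.
Implicit Types (p q s t : R) (n m k : int).

(** The circles have radius sqrt 2 and even centres: in the coordinates used below they are the unit
    circles about the points of E, which bound all cells. The integer lines contain the sides of all
    tiles. As one translation-invariant predicate, it serves both z and w. *)
Definition generic p q :=
  (forall n m, (p - 2 * n%:~R) ^+ 2 + (q - 2 * m%:~R) ^+ 2 <> 2) /\
  (forall k, p <> k%:~R /\ q <> k%:~R).

(* V(a) for a = n alpha + m alpha^*. *)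
Definition cell n m p q :=
  [/\ p ^+ 2 + q ^+ 2 <= 2,
      0 < n -> 2 <= (p + 2) ^+ 2 + q ^+ 2,
      n < 0 -> 2 <= (p - 2) ^+ 2 + q ^+ 2,
      0 < m -> 2 <= p ^+ 2 + (q + 2) ^+ 2 &
      m < 0 -> 2 <= p ^+ 2 + (q - 2) ^+ 2].

Definition inL1 s t :=
  2 * `|s| <= s ^+ 2 + t ^+ 2 /\ 2 * `|t| <= s ^+ 2 + t ^+ 2.

(* Omega at (z, w), where z and w have coordinates (p, q) and (s, t). *)
Definition inOmega p q s t :=
  [/\ p ^+ 2 + q ^+ 2 <= 2, inL1 s t,
      ((p - 2) ^+ 2 + q ^+ 2 <= 2 -> s <= 1) /\
      ((p + 2) ^+ 2 + q ^+ 2 <= 2 -> -1 <= s),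
      p ^+ 2 + (q - 2) ^+ 2 <= 2 -> t <= 1 &
      p ^+ 2 + (q + 2) ^+ 2 <= 2 -> -1 <= t].

(* The image of Omega under (z, w) |-> (-1/z, -1/w): the complements of the four
   disks of L1 become the square |s|, |t| <= 1. *)
Definition inJOmega p q s t :=
  [/\ 2 <= p ^+ 2 + q ^+ 2, `|s| <= 1 /\ `|t| <= 1,
      ((p - 2) ^+ 2 + q ^+ 2 <= 2 -> 2 * s <= s ^+ 2 + t ^+ 2) /\
      ((p + 2) ^+ 2 + q ^+ 2 <= 2 -> - (2 * s) <= s ^+ 2 + t ^+ 2),
      p ^+ 2 + (q - 2) ^+ 2 <= 2 -> 2 * t <= s ^+ 2 + t ^+ 2 &
      p ^+ 2 + (q + 2) ^+ 2 <= 2 -> - (2 * t) <= s ^+ 2 + t ^+ 2].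

Lemma generic_shift n m p q :
  generic p q -> generic (p - 2 * n%:~R) (q - 2 * m%:~R).
Proof.
move=> [H1 H2]; split=> [n' m'|k].
  have := H1 (n + n') (m + m'); rewrite !intrD => H E; apply: H; rewrite -[RHS]E.
  by ring.
split=> E.
  apply: (H2 (k + 2 * n)).1; rewrite intrD intrM ?mulr1z; lra.
apply: (H2 (k + 2 * m)).2; rewrite intrD intrM ?mulr1z; lra.
Qed.

Lemma generic_unshift n m p q :
  generic (p - 2 * n%:~R) (q - 2 * m%:~R) -> generic p q.
Proof.
move=> /(@generic_shift (- n) (- m)); rewrite !intrN !mulrN !opprK.
by rewrite !subrK.
Qed.

Lemma int_norm_lt2 n m :
  2 * n%:~R ^+ 2 + 2 * m%:~R ^+ 2 < 4 :> R ->
  [\/ n = 0 /\ m = 0, n = 1 /\ m = 0, n = -1 /\ m = 0 |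
      n = 0 /\ (m = 1 \/ m = -1)].
Proof.
move=> H.
have {}H : n ^+ 2 + m ^+ 2 < 2.
  rewrite -(ltr_int R) intrD !rmorphXn /= (_ : 2%:~R = 2 :> R) //.
  lra.
have [n1 n2 m1 m2] : [/\ -1 <= n, n <= 1, -1 <= m & m <= 1].
  by split; nia.
have : m = 0 \/ m = 1 \/ m = -1 by lia.
have : n = 0 \/ n = 1 \/ n = -1 by lia.
move: H => /[swap] -[->|[->|->]] /[swap] -[->|[->|->]] // _.
- by constructor 1.
- by constructor 4; split => //; left.
- by constructor 4; split => //; right.
- by constructor 2.
- by constructor 3.
Qed.

(** A generic point lies in the open disks about both centres, so these are equal or adjacent. If
    adjacent, the cell whose centre is farther from 0 has the disk of the other one removed. *)
Lemma cell_uniq n m n' m' p q : generic p q ->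
  cell n m (p - 2 * n%:~R) (q - 2 * m%:~R) ->
  cell n' m' (p - 2 * n'%:~R) (q - 2 * m'%:~R) -> n = n' /\ m = m'.
Proof.
move=> [gen _].
have ltc k l : (p - 2 * k%:~R) ^+ 2 + (q - 2 * l%:~R) ^+ 2 <= 2 ->
    (p - 2 * k%:~R) ^+ 2 + (q - 2 * l%:~R) ^+ 2 < 2.
  by rewrite le_eqVlt => /orP[/eqP/gen|].
move=> [/ltc h n_gt0 n_lt0 m_gt0 m_lt0] [/ltc h' n'_gt0 n'_lt0 m'_gt0 m'_lt0].
(* Parallelogram law: the squared distances to the two centres add up to less than 4. *)
have : 2 * (n' - n)%:~R ^+ 2 + 2 * (m' - m)%:~R ^+ 2 < 4 :> R.
  rewrite !intrB.
  set N : R := n%:~R in h *; set N' : R := n'%:~R in h' *.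
  set M : R := m%:~R in h *; set M' : R := m'%:~R in h' *.
  have := sqr_ge0 (p - 2 * N + (p - 2 * N')).
  have := sqr_ge0 (q - 2 * M + (q - 2 * M')).
  lra.
case/int_norm_lt2 => -[/(canRL (subrK _)) En Em]; subst n'.
- by rewrite (canRL (subrK _) Em) !add0r.
- exfalso; move: h' n'_gt0 n'_lt0; rewrite (canRL (subrK _) Em) add0r.
  rewrite (_ : p - _ = p - 2 * n%:~R - 2) => [h' n'_gt0 _|]; last first.
    by rewrite intrD mulr1z; ring.
  have [/n_lt0|n0] := ltP n 0; first by rewrite leNgt h'.
  have : 0 < 1 + n by apply: ltr_wpDr.
  by move=> /n'_gt0; rewrite subrK leNgt h.
- exfalso; move: h' n'_gt0 n'_lt0; rewrite (canRL (subrK _) Em) add0r.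
  rewrite (_ : p - _ = p - 2 * n%:~R + 2) => [h' _ n'_lt0|]; last first.
    by rewrite intrD intrN mulr1z; ring.
  have [/n_gt0|n0] := ltP 0 n; first by rewrite leNgt h'.
  have : -1 + n < 0 by rewrite (le_lt_trans _ (ltrN10 _)) // gerDl.
  by move=> /n'_lt0; rewrite addrK leNgt h.
- exfalso; rewrite add0r in h' m'_gt0 m'_lt0.
  move: Em h' m'_gt0 m'_lt0 => [] /(canRL (subrK _)) ->.
    rewrite (_ : q - _ = q - 2 * m%:~R - 2) => [h' m'_gt0 _|]; last first.
      by rewrite intrD mulr1z; ring.
    have [/m_lt0|m0] := ltP m 0; first by rewrite leNgt h'.
    have : 0 < 1 + m by apply: ltr_wpDr.
    by move=> /m'_gt0; rewrite subrK leNgt h.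
  rewrite (_ : q - _ = q - 2 * m%:~R + 2) => [h' _ m'_lt0|]; last first.
    by rewrite intrD intrN mulr1z; ring.
  have [/m_gt0|m0] := ltP 0 m; first by rewrite leNgt h'.
  have : -1 + m < 0 by rewrite (le_lt_trans _ (ltrN10 _)) // gerDl.
  by move=> /m'_lt0; rewrite addrK leNgt h.
Qed.

(* Two closed intervals of length 2 with centres differing by an even integer
   only share an odd integer. *)
Lemma tile_uniq n n' s : (forall k, s <> k%:~R) ->
  `|s - 2 * n%:~R| <= 1 -> `|s - 2 * n'%:~R| <= 1 -> n = n'.
Proof.
move=> gen; rewrite !ler_norml => /andP[h1 h2] /andP[h3 h4].
have E a b : s - 2 * a%:~R <= 1 -> -1 <= s - 2 * b%:~R -> b <= a.
  move=> ha hb; rewrite leNgt; apply/negP => ab.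
  have : a + 1 <= b by rewrite lezD1.
  rewrite -(ler_int R) intrD mulr1z => {}ab.
  apply: (gen (2 * a + 1)); rewrite intrD intrM ?mulr1z; lra.
by apply/eqP; rewrite eq_le !E.
Qed.

Lemma tile_exists s : exists n, `|s - 2 * n%:~R| <= 1.
Proof.
exists (Num.floor ((s + 1) / 2)); rewrite ler_norml.
have /andP[] := floor_itv ((s + 1) / 2); rewrite intrD mulr1z.
set z : R := _%:~R => h1 h2.
by apply/andP; split; lra.
Qed.

(** The open unit disks about (0, 1) and (0, -1) lie in the strip |s| < 1. *)
Lemma sq_ge s t : 1 <= `|s| -> 2 * `|t| <= s ^+ 2 + t ^+ 2.
Proof.
rewrite -(real_normK (num_real s)) -(real_normK (num_real t)) => s1.
have := sqr_ge0 (`|t| - 1); nra.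
Qed.

Lemma tile_ge1 n s : `|s| <= 1 -> n != 0 -> 1 <= `|s - 2 * n%:~R|.
Proof.
rewrite ler_norml => /andP[s1 s2]; rewrite neq_lt => /orP[|].
  move=> n0; have : n + 1 <= 0 by rewrite lezD1.
  rewrite -(ler_int R) intrD mulr1z => {}n0.
  rewrite ger0_norm; lra.
rewrite gtz0_ge1 -(ler_int R) mulr1z => n0.
rewrite ler0_norm; lra.
Qed.

Lemma inL1_swap s t : inL1 s t -> inL1 t s.
Proof. by rewrite /inL1 (addrC (t ^+ 2)) => -[]. Qed.

(** A shift by 2 takes the disk about (1, 0) to the one about (-1, 0), so for n = 1 or -1 the disk
    to be avoided is the one excluded by hypothesis. For larger |n| the point is at least 2 away
    from the axis s = 0, beyond both disks. *)
Lemma inL1_axis n s t : n != 0 -> `|s| <= 1 ->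
  (n = 1 -> 2 * s <= s ^+ 2 + t ^+ 2) ->
  (n = -1 -> - (2 * s) <= s ^+ 2 + t ^+ 2) -> inL1 (s - 2 * n%:~R) t.
Proof.
move=> n0 s1 sa sNa; split; last exact/sq_ge/tile_ge1.
have [n1|n1] := eqVneq n 1.
  rewrite n1 mulr1z; have := sa n1.
  move: s1; rewrite ler_norml => /andP[s1 s2].
  rewrite ler0_norm; lra.
have [n2|n2] := eqVneq n (-1).
  rewrite n2 intrN mulr1z; have := sNa n2.
  move: s1; rewrite ler_norml => /andP[s1 s2].
  rewrite ger0_norm; lra.
rewrite -(real_normK (num_real (s - _))).
suff : 2 <= `|s - 2 * n%:~R|.
  move: `|_| => x; have := sqr_ge0 t; nra.
move: s1; rewrite ler_norml => /andP[s1 s2].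
have [n_gt|n_le] := ltP 0 n.
  have : 2 <= n by clear -n_gt n1; lia.
  rewrite -(ler_int R) => ?; rewrite ler0_norm; lra.
have : n <= -2 by clear -n_le n0 n2; lia.
rewrite -(ler_int R) intrN => ?; rewrite ger0_norm; lra.
Qed.

Lemma inJOmega_map n m p q s t : generic p q ->
  cell n m (p - 2 * n%:~R) (q - 2 * m%:~R) -> inJOmega p q s t ->
  inOmega (p - 2 * n%:~R) (q - 2 * m%:~R) (s - 2 * n%:~R) (t - 2 * m%:~R).
Proof.
move=> gen [pq_le n_gt0 n_lt0 m_gt0 m_lt0] [pq_ge [s1 t1] [sa sNa] ta tNa].
have gen' k l := (generic_shift n m gen).1 k l.
split => //.
(* For n = m = 0 the cell and [inJOmega] put (p, q) on a forbidden circle. On the axes [inL1_axis]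
   applies, and elsewhere both coordinates have moved out of the strips of [sq_ge]. *)
- have [n0|n0] := eqVneq n 0; have [m0|m0] := eqVneq m 0.
  + exfalso; subst n m; apply: (gen.1 0 0).
    move: pq_le; rewrite mulr0 !subr0; lra.
  + apply: inL1_swap; rewrite n0 mulr0 !subr0 in pq_le *.
    apply: inL1_axis => // m1; rewrite addrC; rewrite m1 in pq_le.
      by apply: ta; move: pq_le; rewrite mulr1z; lra.
    by apply: tNa; move: pq_le; rewrite intrN mulr1z; lra.
  + rewrite m0 mulr0 !subr0 in pq_le *.
    apply: inL1_axis => // n1; rewrite n1 in pq_le.
      by apply: sa; move: pq_le; rewrite mulr1z; lra.
    by apply: sNa; move: pq_le; rewrite intrN mulr1z; lra.
  + split; first rewrite [leRHS]addrC; exact/sq_ge/tile_ge1.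
(* A point of the cell in the disk about (2, 0) forces n >= 0, since for n < 0 that disk was cut
   out; then s - 2n <= s <= 1. The other three conditions are symmetric. *)
- move: s1; rewrite ler_norml => /andP[s1 s2]; split=> h.
    have [n0|] := ltP n 0.
      by case: (gen' 1 0); rewrite mulr0 subr0 mulr1z mulr1; apply/le_anti;
        rewrite h (n_lt0 n0).
    rewrite -(ler_int R) => n0; lra.
  have [n0|] := ltP 0 n.
    by case: (gen' (-1) 0); rewrite mulr0 subr0 mulrN1z mulrN1 opprK; apply/le_anti;
        rewrite h (n_gt0 n0).
  rewrite -(ler_int R) => n0; lra.
- move: t1; rewrite ler_norml => /andP[t1 t2] h.
  have [m0|] := ltP m 0.
    by case: (gen' 0 1); rewrite mulr0 subr0 mulr1z mulr1; apply/le_anti;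
        rewrite h (m_lt0 m0).
  rewrite -(ler_int R) => m0; lra.
- move: t1; rewrite ler_norml => /andP[t1 t2] h.
  have [m0|] := ltP 0 m.
    by case: (gen' 0 (-1)); rewrite mulr0 subr0 mulrN1z mulrN1 opprK; apply/le_anti;
        rewrite h (m_gt0 m0).
  rewrite -(ler_int R) => m0; lra.
Qed.

Lemma inOmega_inv n m p q s t : generic p q -> generic s t ->
  `|s| <= 1 -> `|t| <= 1 ->
  inOmega (p - 2 * n%:~R) (q - 2 * m%:~R) (s - 2 * n%:~R) (t - 2 * m%:~R) ->
  cell n m (p - 2 * n%:~R) (q - 2 * m%:~R) /\ inJOmega p q s t.
Proof.
move=> gen [_ genst] s1 t1 [pq_le L1st [sa sNa] ta tNa].
have lt1 (x : R) : (forall k, x <> k%:~R) -> `|x| <= 1 -> -1 < x < 1.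
  move=> genx x1; rewrite -ltr_norml lt_neqAle x1 andbT.
  apply/eqP => x1E; have [x0|x0] := ler0P x; last first.
    by apply: (genx 1); rewrite mulr1z -x1E gtr0_norm.
  by apply: (genx (-1)); rewrite intrN mulr1z -x1E ler0_norm // opprK.
have /andP[s_gt s_lt] := lt1 s (fun k => (genst k).1) s1.
have /andP[t_gt t_lt] := lt1 t (fun k => (genst k).2) t1.
(* In a disk that should be cut out, the half-plane condition of [inOmega] would push s or t out of
   the open interval (-1, 1). *)
have c : cell n m (p - 2 * n%:~R) (q - 2 * m%:~R).
  split=> //; rewrite ?gtz0_ge1 -?lezD1 => k0; rewrite leNgt; apply/negP => /ltW h.
  - have := sNa h; move: k0; rewrite -(ler_int R) mulr1z; lra.
  - have := sa h; have : n + 1 <= 0 by [].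
    rewrite -(ler_int R) intrD mulr1z; lra.
  - have := tNa h; move: k0; rewrite -(ler_int R) mulr1z; lra.
  - have := ta h; have : m + 1 <= 0 by [].
    rewrite -(ler_int R) intrD mulr1z; lra.
have uniq k l : cell k l (p - 2 * k%:~R) (q - 2 * l%:~R) -> k = n /\ l = m.
  by move=> c'; apply: cell_uniq c' c.
have pq_ge : 2 <= p ^+ 2 + q ^+ 2.
  (* Otherwise (p, q) lies in the cell of 0, so n = m = 0 by uniqueness. Adding the two inequalities
     of [inL1] then gives |s| + |t| <= s^2 + t^2, impossible for 0 < |s|, |t| < 1. *)
  rewrite leNgt; apply/negP => pq_lt.
  have [n0 m0] : 0 = n /\ 0 = m.
    by apply: uniq; rewrite !mulr0 !subr0; split => //; rewrite ltW.
  subst n m; move: L1st; rewrite mulr0 !subr0.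
  have sN0 : 0 < `|s| by rewrite normr_gt0; apply/eqP => /(genst 0).1.
  have tN0 : 0 < `|t| by rewrite normr_gt0; apply/eqP => /(genst 0).2.
  have : `|s| < 1 /\ `|t| < 1 by rewrite !ltr_norml s_gt s_lt t_gt t_lt.
  rewrite /inL1 -(real_normK (num_real s)) -(real_normK (num_real t)).
  move: `|s| `|t| sN0 tN0 => x y x0 y0 [x1 y1] [].
  nra.
split=> //; split => //.
(* A point of the disk about (2, 0) lies in the cell (1, 0), because p^2 + q^2 >= 2. So n = 1 and m
   = 0, and [inL1] at (s - 2, t) is the required bound. The other three disks are alike. *)
- split=> h.
    have [n1 m1] : 1 = n /\ 0 = m.
      by apply: uniq; rewrite mulr1z mulr1 mulr0 subr0; split=> // _; rewrite subrK.
    move: L1st; rewrite -n1 -m1 mulr0 mulr1z subr0 => -[h1 _].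
    have := ler_norm (- (s - 2 * 1)); rewrite normrN; lra.
  have [n1 m1] : -1 = n /\ 0 = m.
    by apply: uniq; rewrite mulrN1z mulrN1 opprK mulr0 subr0; split=> // _; rewrite addrK.
  move: L1st; rewrite -n1 -m1 mulr0 intrN mulr1z subr0 => -[h1 _].
  have := ler_norm (s - 2 * -1); lra.
- move=> h; have [n1 m1] : 0 = n /\ 1 = m.
    by apply: uniq; rewrite mulr1z mulr1 mulr0 subr0; split=> // _; rewrite subrK.
  move: L1st; rewrite -n1 -m1 mulr0 mulr1z subr0 => -[_ h1].
  have := ler_norm (- (t - 2 * 1)); rewrite normrN; lra.
- move=> h; have [n1 m1] : 0 = n /\ -1 = m.
    by apply: uniq; rewrite mulrN1z mulrN1 opprK mulr0 subr0; split=> // _; rewrite addrK.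
  move: L1st; rewrite -n1 -m1 mulr0 intrN mulr1z subr0 => -[_ h1].
  have := ler_norm (t - 2 * -1); lra.
Qed.
End Real.

(** * Coordinates of the sets of the statement *)

Section Cplx.
Variable R : realType.
Local Notation C := R[i].
Implicit Types (u v w z a : C) (n m : int).

(* In the coordinates (Re + Im, Re - Im) the lattice E becomes (2Z)^2, with
   alpha = (2, 0) and its conjugate = (0, 2), and |w|^2 = (s^2 + t^2) / 2. *)
Definition sumc w : R := complex.Re w + complex.Im w.
Definition difc w : R := complex.Re w - complex.Im w.

Lemma sumc_difc_inj z w : sumc z = sumc w -> difc z = difc w -> z = w.
Proof.
case: z w => [x y] [x' y']; rewrite /sumc /difc /= => h1 h2.
by congr Complex; lra.
Qed.

Lemma sumcB z w : sumc (z - w) = sumc z - sumc w.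
Proof. by case: z w => [x y] [x' y']; rewrite /sumc /=; ring. Qed.

Lemma difcB z w : difc (z - w) = difc z - difc w.
Proof. by case: z w => [x y] [x' y']; rewrite /difc /=; ring. Qed.

Lemma sumcD z w : sumc (z + w) = sumc z + sumc w.
Proof. by case: z w => [x y] [x' y']; rewrite /sumc /=; ring. Qed.

Lemma difcD z w : difc (z + w) = difc z + difc w.
Proof. by case: z w => [x y] [x' y']; rewrite /difc /=; ring. Qed.

Lemma iE : 'i = 'i%C :> C.
Proof. by []. Qed.

Lemma sumc_i w : sumc ('i * w) = difc w.
Proof. by rewrite iE; case: w => [x y]; rewrite /sumc /difc /=; ring. Qed.

Lemma difc_i w : difc ('i * w) = - sumc w.
Proof. by rewrite iE; case: w => [x y]; rewrite /sumc /difc /=; ring. Qed.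

Lemma sumc_oppinv w :
  sumc (- w^-1) = - (2 * difc w / (sumc w ^+ 2 + difc w ^+ 2)).
Proof.
case: w => [x y]; rewrite /sumc /difc /=.
rewrite (_ : (x + y) ^+ 2 + _ = 2 * (x ^+ 2 + y ^+ 2)); last by ring.
by rewrite invfM; set Q := (x ^+ 2 + y ^+ 2)^-1; field.
Qed.

Lemma difc_oppinv w :
  difc (- w^-1) = - (2 * sumc w / (sumc w ^+ 2 + difc w ^+ 2)).
Proof.
case: w => [x y]; rewrite /sumc /difc /=.
rewrite (_ : (x + y) ^+ 2 + _ = 2 * (x ^+ 2 + y ^+ 2)); last by ring.
by rewrite invfM; set Q := (x ^+ 2 + y ^+ 2)^-1; field.
Qed.

Lemma norm_lt (r : R) w : 0 <= r ->
  (`|w| < r%:C%C) = (sumc w ^+ 2 + difc w ^+ 2 < 2 * r ^+ 2).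
Proof.
move=> r0; case: w => [x y]; rewrite normc_def ltcR /sumc /difc /=.
rewrite -{1}(ger0_norm r0) -sqrtr_sqr.
rewrite (_ : (x + y) ^+ 2 + _ = 2 * (x ^+ 2 + y ^+ 2)); last by ring.
rewrite ltr_pM2l // !ltNge; congr negb.
by rewrite ler_sqrt // addr_ge0 ?sqr_ge0.
Qed.

Lemma norm_lt1 w : (`|w| < 1) = (sumc w ^+ 2 + difc w ^+ 2 < 2).
Proof. by rewrite (norm_lt _ ler01) expr1n mulr1. Qed.

Lemma norm_ge1 w : (1 <= `|w|) = (2 <= sumc w ^+ 2 + difc w ^+ 2).
Proof.
by rewrite real_leNgt ?real1 ?normr_real // norm_lt1 -leNgt.
Qed.

Lemma norm_le1 w : (`|w| <= 1) = (sumc w ^+ 2 + difc w ^+ 2 <= 2).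
Proof.
case: w => [x y]; rewrite normc_def -[1]/(1%:C%C) lecR /sumc /difc /=.
rewrite -[X in _ <= X]sqrtr1 ler_sqrt //.
by apply/idP/idP; lra.
Qed.

Lemma mul_i_oppi : 'i * - 'i = 1 :> C.
Proof. by rewrite mulrN -expr2 sqrCi opprK. Qed.

Lemma turnP (A : set C) w : turn A w <-> A ('i * w).
Proof.
split=> [[v Av <-]|Aw]; first by rewrite mulrA mul_i_oppi mul1r.
by exists ('i * w) => //; rewrite mulrA mulNr -mulrN mul_i_oppi mul1r.
Qed.

Lemma turnSP (A : set (sphere R)) w :
  turnS A (Some w) <-> A (Some ('i * w)).
Proof.
split=> [[[v|] Av //= [<-]]|Aw]; first by rewrite mulrA mul_i_oppi mul1r.
by exists (Some ('i * w)) => //=; rewrite mulrA mulNr -mulrN mul_i_oppi mul1r.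
Qed.

(** * The cells V(a) *)

Lemma sumc_alpha : sumc (@alpha R) = 2.
Proof. by rewrite /sumc /=; ring. Qed.

Lemma difc_alpha : difc (@alpha R) = 0.
Proof. by rewrite /difc /=; ring. Qed.

Definition cell_at a w :=
  exists n m, [/\ sumc a = 2 * n%:~R, difc a = 2 * m%:~R &
    cell n m (sumc w) (difc w)].

(** The cell description is invariant under the quarter turn, which reduces all indices j > 0 to j =
    1 and j = 5. *)
Lemma cell_at_turn a w : cell_at ('i * a) ('i * w) -> cell_at a w.
Proof.
move=> [n [m]]; rewrite !sumc_i !difc_i => -[Da Sa [le2 n_gt n_lt m_gt m_lt]].
exists (- m), n; split => //; first by rewrite intrN; lra.
split; rewrite ?oppr_gt0 ?oppr_lt0; first lra.
- by move/m_lt; lra.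
- by move/m_gt; lra.
- by move/n_gt; lra.
- by move/n_lt; lra.
Qed.

Lemma sumc_natM (k : nat) w : sumc (k%:R * w) = k%:R * sumc w.
Proof. by rewrite mulr_natl /sumc !raddfMn /= -mulrnDl mulr_natl. Qed.

Lemma difc_natM (k : nat) w : difc (k%:R * w) = k%:R * difc w.
Proof. by rewrite mulr_natl /difc !raddfMn /= -mulrnDl mulr_natl. Qed.

Lemma V1P w : V1 w <->
  sumc w ^+ 2 + difc w ^+ 2 <= 2 /\ 2 <= (sumc w + 2) ^+ 2 + difc w ^+ 2.
Proof.
by rewrite /V1 /= /disk /= norm_le1 norm_ge1 sumcD difcD sumc_alpha difc_alpha addr0.
Qed.

Lemma cell_at1 a w : @Epart R 1 a -> @V R 1 w -> cell_at a w.
Proof.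
move=> [n [n0 ->]] /V1P[le2 ge2].
exists n%:Z, 0; rewrite sumc_natM difc_natM sumc_alpha difc_alpha.
split; [by rewrite mulrC|by rewrite !mulr0|].
by split => //; rewrite ltNge lez_nat.
Qed.

Lemma cell_at5 a w : @Epart R 5 a -> @V R 5 w -> cell_at a w.
Proof.
move=> [n [m [n0 m0 ->]]] [/V1P[le2 ge2]] /turnP/V1P[_].
rewrite sumc_i difc_i => ge2'.
have [Sc Dc] : sumc (@alpha R)^* = 0 /\ difc (@alpha R)^* = 2.
  have -> : (@alpha R)^* = Complex 1 (- 1) :> C.
    transitivity (Complex (1 + 0) (- (0 + 1)) : C); first by [].
    by rewrite addr0 add0r.
  by rewrite /sumc /difc /=; split; ring.
exists n%:Z, m%:Z; rewrite sumcD difcD !sumc_natM !difc_natM sumc_alpha difc_alpha Sc Dc.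
split; [by rewrite mulr0 addr0 mulrC|by rewrite mulr0 add0r mulrC|].
split => //; rewrite ?(ltNge _ 0) ?lez_nat //; lra.
Qed.

Lemma Vof_cell a w : Vof a w -> cell_at a w.
Proof.
move=> [j [j8 Ea Vw]].
have step k : (forall b v, @Epart R k b -> @V R k v -> cell_at b v) ->
    forall b v, turn (@Epart R k) b -> turn (@V R k) v -> cell_at b v.
  by move=> h b v /turnP Eb /turnP Vv; apply/cell_at_turn/h.
have good2 := step 1 cell_at1; have good3 := step 2 good2.
have good4 := step 3 good3.
have good6 := step 5 cell_at5; have good7 := step 6 good6.
have good8 := step 7 good7.
case: j j8 Ea Vw => [_ -> w1|].
  exists 0, 0; rewrite /sumc /difc /= mulr0 subr0 addr0; split => //.
  by split => //; rewrite -norm_le1.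
case; first by move=> _; apply: cell_at1.
case; first by move=> _; apply: good2.
case; first by move=> _; apply: good3.
case; first by move=> _; apply: good4.
case; first by move=> _; apply: cell_at5.
case; first by move=> _; apply: good6.
case; first by move=> _; apply: good7.
case; first by move=> _; apply: good8.
by move=> ?.
Qed.

(** * The sets K_j *)

Lemma sumc_K2 : sumc (- 1 + 'i : C) = 0.
Proof. by rewrite iE /sumc /=; ring. Qed.

Lemma difc_K2 : difc (- 1 + 'i : C) = - 2.
Proof. by rewrite iE /difc /=; ring. Qed.

Lemma K2P z : K2 z <->
  sumc z ^+ 2 + difc z ^+ 2 <= 2 /\ sumc z ^+ 2 + (difc z + 2) ^+ 2 <= 2.
Proof.
by rewrite /K2 /= /disk /= !norm_le1 sumcB difcB sumc_K2 difc_K2 subr0 opprK.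
Qed.

Lemma K3P z : K3 z <->
  sumc z ^+ 2 + difc z ^+ 2 <= 2 /\ (sumc z - 2) ^+ 2 + difc z ^+ 2 <= 2.
Proof.
split; [move=> /turnP/K2P|move=> h; apply/turnP/K2P; move: h];
  by rewrite sumc_i difc_i => -[? ?]; split; lra.
Qed.

Lemma K4P z : K4 z <->
  sumc z ^+ 2 + difc z ^+ 2 <= 2 /\ sumc z ^+ 2 + (difc z - 2) ^+ 2 <= 2.
Proof.
split; [move=> /turnP/K3P|move=> h; apply/turnP/K3P; move: h];
  by rewrite sumc_i difc_i => -[? ?]; split; lra.
Qed.

Lemma K5P z : K5 z <->
  sumc z ^+ 2 + difc z ^+ 2 <= 2 /\ (sumc z + 2) ^+ 2 + difc z ^+ 2 <= 2.
Proof.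
split; [move=> /turnP/K4P|move=> h; apply/turnP/K4P; move: h];
  by rewrite sumc_i difc_i => -[? ?]; split; lra.
Qed.

Lemma closure_norm_le (A : set C) c z :
  (forall w, A w -> `|w - c| <= 1) -> closure (A : set C^o) z -> `|z - c| <= 1.
Proof.
move=> Ac clz; rewrite real_leNgt ?real1 ?normr_real //; apply/negP => zc.
have e0 : 0 < `|z - c| - 1 by rewrite subr_gt0.
have [w [/Ac wc]] := clz _ (nbhsx_ballx (z : C^o) _ e0).
rewrite -ball_normE /= => zw.
have := le_lt_trans (ler_normD (z - w) (w - c)) (ltr_leD zw wc).
by rewrite addrA subrK subrK ltxx.
Qed.

Lemma closure_norm_ge (A : set C) c z :
  (forall w, A w -> 1 <= `|w - c|) -> closure (A : set C^o) z -> 1 <= `|z - c|.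
Proof.
move=> Ac clz; rewrite real_leNgt ?real1 ?normr_real //; apply/negP => zc.
have e0 : 0 < 1 - `|z - c| by rewrite subr_gt0.
have [w [/Ac wc]] := clz _ (nbhsx_ballx (z : C^o) _ e0).
rewrite -ball_normE /= distrC => zw.
have := le_lt_trans (ler_normD (w - z) (z - c)) (ltr_leD zw (lexx _)).
rewrite addrA !subrK => /(le_lt_trans wc).
by rewrite ltxx.
Qed.

Definition offK z :=
  [/\ (sumc z - 2) ^+ 2 + difc z ^+ 2 <> 2, (sumc z + 2) ^+ 2 + difc z ^+ 2 <> 2,
      sumc z ^+ 2 + (difc z - 2) ^+ 2 <> 2 & sumc z ^+ 2 + (difc z + 2) ^+ 2 <> 2].

(** The non-strict inequalities hold on the set difference and pass to its closure. Conversely, off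
    the four circles they become strict outside K_2, ..., K_5, so z is in the difference itself. *)
Lemma K1P z : offK z -> K1 z <->
  [/\ sumc z ^+ 2 + difc z ^+ 2 <= 2,
      2 <= (sumc z - 2) ^+ 2 + difc z ^+ 2, 2 <= (sumc z + 2) ^+ 2 + difc z ^+ 2,
      2 <= sumc z ^+ 2 + (difc z - 2) ^+ 2 & 2 <= sumc z ^+ 2 + (difc z + 2) ^+ 2].
Proof.
move=> [g1 g2 g3 g4]; split.
  have far c : (forall w, (@disk R `\` (@K2 R `|` @K3 R `|` @K4 R `|` @K5 R)) w ->
      2 <= (sumc w - sumc c) ^+ 2 + (difc w - difc c) ^+ 2) -> K1 z ->
      2 <= (sumc z - sumc c) ^+ 2 + (difc z - difc c) ^+ 2.
    move=> h clz; rewrite -sumcB -difcB -norm_ge1.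
    by apply: closure_norm_ge clz => w /h; rewrite -sumcB -difcB -norm_ge1.
  have pt x y : exists c, sumc c = x /\ difc c = y.
    exists (Complex ((x + y) / 2) ((x - y) / 2)).
    by rewrite /sumc /difc /=; split; field.
  have K1far x y : (forall w, (@disk R `\` (@K2 R `|` @K3 R `|` @K4 R `|` @K5 R)) w ->
      2 <= (sumc w + x) ^+ 2 + (difc w + y) ^+ 2) -> K1 z ->
      2 <= (sumc z + x) ^+ 2 + (difc z + y) ^+ 2.
    have [c [cx cy]] := pt (- x) (- y).
    by move=> h clz; have := far c; rewrite cx cy !opprK; apply.
  have not w : (@disk R `\` (@K2 R `|` @K3 R `|` @K4 R `|` @K5 R)) w ->
    [/\ 2 <= (sumc w - 2) ^+ 2 + difc w ^+ 2, 2 <= (sumc w + 2) ^+ 2 + difc w ^+ 2,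
      2 <= sumc w ^+ 2 + (difc w - 2) ^+ 2 & 2 <= sumc w ^+ 2 + (difc w + 2) ^+ 2].
    rewrite /disk /= norm_le1 => -[le2 nK].
    split; rewrite leNgt; apply/negP => /ltW lt2; apply: nK.
    - by left; left; right; apply/K3P.
    - by right; apply/K5P.
    - by left; right; apply/K4P.
    - by left; left; left; apply/K2P.
  move=> clz; split.
  - rewrite -norm_le1 -[z]subr0; apply: closure_norm_le clz => w [].
    by rewrite subr0.
  - by have := K1far (-2) 0; rewrite addr0; apply=> // w /not[]; rewrite addr0.
  - by have := K1far 2 0; rewrite addr0; apply=> // w /not[]; rewrite addr0.
  - by have := K1far 0 (-2); rewrite addr0; apply=> // w /not[]; rewrite addr0.
  - by have := K1far 0 2; rewrite addr0; apply=> // w /not[]; rewrite addr0.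
move=> [le2 h1 h2 h3 h4]; apply: subset_closure; split.
  by rewrite /disk /= norm_le1.
by case=> [[[/K2P|/K3P]|/K4P]|/K5P] [_ h]; [case: g4|case: g1|case: g3|case: g2]; lra.
Qed.

(** * The sets L_j *)

Lemma BP c w : B c (Num.sqrt 2)^-1 w <->
  (sumc w - sumc c) ^+ 2 + (difc w - difc c) ^+ 2 < 1.
Proof.
rewrite /B -ball_normE /= distrC norm_lt ?invr_ge0 ?sqrtr_ge0 //.
by rewrite sumcB difcB exprVn sqr_sqrtr // mulfV.
Qed.

(** The four disks become unit disks about (1, 0), (0, -1), (-1, 0), (0, 1). Their circles pass
    through the origin, so each equation is of the form 2s = s^2 + t^2 up to sign and swap, and an
    absolute value joins opposite disks. *)
Lemma L1P w : L1 (Some w) <-> inL1 (sumc w) (difc w).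
Proof.
have E1 : sumc ((1 + 'i) / 2 : C) = 1 /\ difc ((1 + 'i) / 2 : C) = 0.
  by rewrite iE /sumc /difc /=; split; field.
have E2 : sumc ((- 1 + 'i) / 2 : C) = 0 /\ difc ((- 1 + 'i) / 2 : C) = -1.
  by rewrite iE /sumc /difc /=; split; field.
have E3 : sumc ((- 1 - 'i) / 2 : C) = -1 /\ difc ((- 1 - 'i) / 2 : C) = 0.
  by rewrite iE /sumc /difc /=; split; field.
have E4 : sumc ((1 - 'i) / 2 : C) = 0 /\ difc ((1 - 'i) / 2 : C) = 1.
  by rewrite iE /sumc /difc /=; split; field.
split=> [nB|[h1 h2]].
  split; rewrite leNgt; apply/negP => h; apply: nB; exists w => //.
    have [s0|s0] := ler0P (sumc w); rewrite ?(ler0_norm s0) ?(gtr0_norm s0) in h.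
      by left; right; apply/BP; rewrite E3.1 E3.2; lra.
    by left; left; left; apply/BP; rewrite E1.1 E1.2; lra.
  have [t0|t0] := ler0P (difc w); rewrite ?(ler0_norm t0) ?(gtr0_norm t0) in h.
    by left; left; right; apply/BP; rewrite E2.1 E2.2; lra.
  by right; apply/BP; rewrite E4.1 E4.2; lra.
have := ler_norm (sumc w); have := ler_norm (difc w).
have := ler_norm (- sumc w); have := ler_norm (- difc w); rewrite !normrN => ? ? ? ?.
by case=> v + [vw]; rewrite vw => -[[[]|]|] /BP;
  rewrite ?(E1.1, E1.2, E2.1, E2.2, E3.1, E3.2, E4.1, E4.2); lra.
Qed.

Lemma L2P w : L2 (Some w) <-> inL1 (sumc w) (difc w) /\ -1 <= difc w.
Proof.
have E : (complex.Re w + 1 < complex.Im w) = (difc w < -1).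
  by rewrite /difc; apply/idP/idP; lra.
split=> [[/L1P L1w nH]|[/L1P L1w Dw]]; split=> //.
  by rewrite leNgt -E; apply/negP => h; apply: nH; exists w.
by case=> v + [vw]; rewrite vw /= E; lra.
Qed.

Lemma inL1_turn (s t : R) : inL1 s t <-> inL1 t (- s).
Proof. by rewrite /inL1 normrN sqrrN (addrC (t ^+ 2)); split=> -[]. Qed.

Lemma L3P w : L3 (Some w) <-> inL1 (sumc w) (difc w) /\ sumc w <= 1.
Proof.
split; [move=> /turnSP/L2P|move=> h; apply/turnSP/L2P; move: h];
  by rewrite sumc_i difc_i -inL1_turn lerN2.
Qed.

Lemma L4P w : L4 (Some w) <-> inL1 (sumc w) (difc w) /\ difc w <= 1.
Proof.
split; [move=> /turnSP/L3P|move=> h; apply/turnSP/L3P; move: h];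
  by rewrite sumc_i difc_i -inL1_turn.
Qed.

Lemma L5P w : L5 (Some w) <-> inL1 (sumc w) (difc w) /\ -1 <= sumc w.
Proof.
split; [move=> /turnSP/L4P|move=> h; apply/turnSP/L4P; move: h];
  by rewrite sumc_i difc_i -inL1_turn lerNl.
Qed.

(** Off the circles K_1, ..., K_5 are disjoint, so at most one half-plane condition is active at
    z. *)
Lemma OmegaP z w : offK z ->
  Omega (z, Some w) <-> inOmega (sumc z) (difc z) (sumc w) (difc w).
Proof.
move=> off; have [g1 g2 g3 g4] := off.
(* Neighbouring disks among those about (2, 0), (-2, 0), (0, 2), (0, -2) are tangent at points with
   coordinates 1 or -1. These squares let [lra] see that the open disks are disjoint. *)
have sp := sqr_ge0 (sumc z + 1); have sm := sqr_ge0 (sumc z - 1).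
have dp := sqr_ge0 (difc z + 1); have dm := sqr_ge0 (difc z - 1).
have s0 := sqr_ge0 (sumc z); have d0 := sqr_ge0 (difc z).
have lt (x : R) : x <> 2 -> x <= 2 -> x < 2.
  by move=> /eqP x2; rewrite le_eqVlt (negbTE x2).
have {}g1 := lt _ g1; have {}g2 := lt _ g2.
have {}g3 := lt _ g3; have {}g4 := lt _ g4.
split.
  case=> [[[[|]|]|]|] [] /=.
  - move=> /(K1P off)[le2 h1 h2 h3 h4] /L1P L1w; split=> //.
    + by split=> [/g1|/g2]; lra.
    + by move=> /g3; lra.
    + by move=> /g4; lra.
  - move=> /K2P[le2 /g4 h] /L2P[L1w h']; split=> //.
    + by split=> [/g1|/g2]; lra.
    + by move=> /g3; lra.
  - move=> /K3P[le2 /g1 h] /L3P[L1w h']; split=> //.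
    + by split=> // /g2; lra.
    + by move=> /g3; lra.
    + by move=> /g4; lra.
  - move=> /K4P[le2 /g3 h] /L4P[L1w h']; split=> //.
    + by split=> [/g1|/g2]; lra.
    + by move=> /g4; lra.
  - move=> /K5P[le2 /g2 h] /L5P[L1w h']; split=> //.
    + by split=> // /g1; lra.
    + by move=> /g3; lra.
    + by move=> /g4; lra.
move=> [le2 L1w [h1 h2] h3 h4].
have [k1|k1] := leP ((sumc z - 2) ^+ 2 + difc z ^+ 2) 2.
  by left; left; right; split; [apply/K3P|apply/L3P; split=> //; apply: h1].
have [k2|k2] := leP ((sumc z + 2) ^+ 2 + difc z ^+ 2) 2.
  by right; split; [apply/K5P|apply/L5P; split=> //; apply: h2].
have [k3|k3] := leP (sumc z ^+ 2 + (difc z - 2) ^+ 2) 2.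
  by left; right; split; [apply/K4P|apply/L4P; split=> //; apply: h3].
have [k4|k4] := leP (sumc z ^+ 2 + (difc z + 2) ^+ 2) 2.
  by left; left; left; right; split; [apply/K2P|apply/L2P; split=> //; apply: h4].
left; left; left; left; split; last exact/L1P.
by apply/(K1P off); split=> //; apply: ltW.
Qed.

End Cplx.

(** * Null sets *)

Section Null.
Variable R : realType.
Local Notation lebesgue2 :=
  (@lebesgue_measure R \x @lebesgue_measure R)%E.

Definition conic (a b c d : R) : set (R * R) :=
  [set q | a * (q.1 ^+ 2 + q.2 ^+ 2) + b * q.1 + c * q.2 + d = 0].

Lemma measurable_conic a b c d : measurable (conic a b c d).
Proof.
pose f (q : R * R) := a * (q.1 ^+ 2 + q.2 ^+ 2) + b * q.1 + c * q.2 + d.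
have mf : measurable_fun [set: R * R] f.
  apply: measurable_funD => //; apply: measurable_funD.
    apply: measurable_funD.
      apply: measurable_funM => //; apply: measurable_funD;
      apply: measurable_funX; [exact: measurable_fst|exact: measurable_snd].
    by apply: measurable_funM => //; exact: measurable_fst.
  by apply: measurable_funM => //; exact: measurable_snd.
have := mf measurableT [set 0] (measurable_set1 _).
by rewrite setTI.
Qed.

(** Fubini: on each vertical line the equation is a nonzero polynomial in the second coordinate, of
    degree at most 2. *)
Lemma conic_null (a b c d : R) : (a != 0) || (c != 0) ->
  lebesgue2.-negligible (conic a b c d).
Proof.
move=> ac0; apply/negligibleP; first exact: measurable_conic.
transitivity (\int[@lebesgue_measure R]_x
    (@lebesgue_measure R) (xsection (conic a b c d) x))%E; first by [].
under eq_integral => x _.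
  rewrite (_ : lebesgue_measure _ = 0%E); last first.
    apply: countable_lebesgue_measure0.
    have [->|/set0P[y0 y0E]] := eqVneq (xsection (conic a b c d) x) set0.
      exact: countable0.
    (* The roots of the quadratic add up to -c/a. For a = 0 the equation is linear and only y0
       occurs. *)
    apply: (@sub_countable _ _ _ [set y0; - c / a - y0]); last first.
      by apply: finite_set_countable.
    apply: subset_card_le => y yE.
    move: y0E yE; rewrite /xsection /conic /= !inE /= => y0E yE.
    have : (y - y0) * (a * (y + y0) + c) = 0 by lra.
    move=> /eqP; rewrite mulf_eq0 => /orP[/eqP h|/eqP h]; [left; lra|right].
    have [a0|a0] := eqVneq a 0.
      by move: ac0 h; rewrite a0 eqxx mul0r add0r /= => /eqP.
    apply: (mulfI a0); rewrite mulrBr mulrCA mulfV // mulr1; lra.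
  over.
by rewrite integral0.
Qed.

(* Every line and circle to be discarded, as well as its image under
   z |-> -1/z, is one of these countably many curves. *)
Definition int_conics : set (R * R) :=
  [set q | exists a b c d : int, (a != 0) || (c != 0) /\
    conic a%:~R b%:~R c%:~R d%:~R q].

Lemma int_conics_null : lebesgue2.-negligible int_conics.
Proof.
pose F (k : nat) : set (R * R) :=
  if unpickle k is Some (a, b, c, d) then
    if (a != 0 :> int) || (c != 0 :> int)
    then conic a%:~R (b : int)%:~R c%:~R (d : int)%:~R else set0
  else set0.
have F0 : lebesgue2.-negligible (\bigcup_k F k).
  apply: negligible_bigcup => k; rewrite /F.
  case: unpickle => [[[[a b] c] d]|]; last exact: negligible_set0.
  case: ifP => [ac|_]; last exact: negligible_set0.
  by apply: conic_null; rewrite !intr_eq0.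
apply: negligibleS F0 => q [a [b [c [d [ac qE]]]]].
exists (pickle (a, b, c, d)); first exact: I.
rewrite /F pickleK ac; exact: qE.
Qed.

End Null.

Section ProductNull.
Context d1 d2 (T1 : measurableType d1) (T2 : measurableType d2) (R : realType).
Variables (m1 : {measure set T1 -> \bar R}) (m2 : {measure set T2 -> \bar R}).

Lemma negligible_setXU (N1 : set T1) (N2 : set T2) :
  m1.-negligible N1 -> m2.-negligible N2 ->
  (m1 \x m2)%E.-negligible (N1 `*` setT `|` setT `*` N2).
Proof.
move=> [M1 [mM1 M10 NM1]] [M2 [mM2 M20 NM2]].
exists (M1 `*` setT `|` setT `*` M2); split.
- by apply: measurableU; apply: measurableX.
- rewrite /product_measure1.
  (* The section at x is everything if x is in M1 and the null set M2 otherwise. The integral is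
     then 0 times the measure of [setT], which is 0 even if that measure is infinite. *)
  rewrite (eq_integral (fun x => (\1_M1 x)%:E * m2 setT)%E); last first.
    move=> x _; rewrite indicE /=.
    have [/set_mem xM|xM] /= := boolP (x \in M1).
      rewrite mul1e; congr (m2 _); apply/seteqP; split=> // y _.
      by rewrite /xsection /= inE; left.
    rewrite mul0e -M20; congr (m2 _); apply/seteqP; split=> y.
      by rewrite /xsection /= inE => -[[/mem_set]|[]//]; rewrite (negbTE xM).
    by rewrite /xsection /= inE; right.
  rewrite ge0_integralZr //; last exact: measurableT_comp.
  by rewrite integral_indic // setIT M10 mul0e.
- by move=> q [[/NM1]|[_ /NM2]]; [left|right].
Qed.

End ProductNull.

Lemma null_C2_conics (R : realType) (N : set (R[i] * sphere R)) :
  (forall z w, N (z, Some w) -> int_conics (complex.Re z, complex.Im z) \/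
     int_conics (complex.Re w, complex.Im w)) -> null_C2 N.
Proof.
move=> h; pose leb := @lebesgue_measure R.
pose leb2 : {measure set _ -> \bar R} := (leb \x leb)%E.
have int0 := @int_conics_null R.
have [M [mM M0 NM]] := @negligible_setXU _ _ _ _ _ leb2 leb2 _ _ int0 int0.
exists M; split=> //.
by move=> [[x y] [x' y']] /= /h [?|?]; apply: NM; [left|right].
Qed.

(** * Bijectivity off the exceptional curves *)

Section Main.
Variable R : realType.
Local Notation C := R[i].
Implicit Types (z w u v : C).

Lemma not_generic (p q : R) : ~ generic p q ->
  (exists n m : int, (p - 2 * n%:~R) ^+ 2 + (q - 2 * m%:~R) ^+ 2 = 2) \/
  (exists k : int, p = k%:~R \/ q = k%:~R).
Proof.
apply: contra_notP => /not_orP[h1 h2]; split=> [n m E|k].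
  by apply: h1; exists n, m.
by split=> E; apply: h2; exists k; [left|right].
Qed.

Lemma not_generic_conic z : ~ generic (sumc z) (difc z) ->
  int_conics (complex.Re z, complex.Im z).
Proof.
rewrite /sumc /difc; case: z => x y /= /not_generic[[n [m E]]|[k [E|E]]].
(* Expansion of (x + y - 2n)^2 + (x - y - 2m)^2 = 2. *)
- exists 2, (- 4 * n - 4 * m), (4 * m - 4 * n), (4 * n ^+ 2 + 4 * m ^+ 2 - 2).
  split=> //; rewrite /conic /= !(intrD, intrN, intrM, rmorphXn) /=.
  lra.
- exists 0, 1, 1, (- k); split=> //.
  by rewrite /conic /= intrN !mulr1z; lra.
- exists 0, 1, (- 1), (- k); split=> //.
  by rewrite /conic /= !intrN !mulr1z; lra.
Qed.

Lemma not_generic_oppinv_conic z : ~ generic (sumc (- z^-1)) (difc (- z^-1)) ->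
  int_conics (complex.Re z, complex.Im z).
Proof.
have [->|z0] := eqVneq z 0.
  (* Since 0^-1 = 0 here, z = 0 needs a curve of its own: the real axis. *)
  move=> _; exists 0, 0, 1, 0; split=> //.
  by rewrite /conic /=; lra.
have Q0 : sumc z ^+ 2 + difc z ^+ 2 != 0.
  apply: contra_neq z0 => /eqP; rewrite paddr_eq0 ?sqr_ge0 // !sqrf_eq0.
  by move=> /andP[/eqP Sz /eqP Dz]; apply: sumc_difc_inj;
    rewrite ?Sz ?Dz /sumc /difc /=; ring.
move: (sumc_oppinv z) (difc_oppinv z); move: (sumc (- z^-1)) (difc (- z^-1)) Q0 => p q.
move QE: (sumc z ^+ 2 + difc z ^+ 2) => Q.
move: QE; rewrite /sumc /difc; case: z {z0} => x y /= QE Q0 pE qE.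
have {}pE : p * Q = - (2 * (x - y)) by rewrite pE; field.
have {}qE : q * Q = - (2 * (x + y)) by rewrite qE; field.
have pqQ : (p ^+ 2 + q ^+ 2) * Q = 4.
  apply: (mulIf Q0); rewrite -mulrA -expr2 mulrDl -!exprMn pE qE -QE; ring.
move=> /not_generic[[n [m E]]|[k [E|E]]].
(* The circle equation times Q = 2(x^2 + y^2). The leading coefficient is nonzero by parity: no
   circle of the family passes through the origin. *)
- exists (8 * n ^+ 2 + 8 * m ^+ 2 - 4), (8 * n + 8 * m), (8 * m - 8 * n), 4.
  split; first by apply/orP; left; lia.
  rewrite /conic /= !(intrD, intrN, intrM, rmorphXn) /=.
  set N : R := n%:~R in E *; set M : R := m%:~R in E *.
  have : ((p - 2 * N) ^+ 2 + (q - 2 * M) ^+ 2 - 2) * Q = 0.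
    by rewrite E subrr mul0r.
  have -> : ((p - 2 * N) ^+ 2 + (q - 2 * M) ^+ 2 - 2) * Q =
    (p ^+ 2 + q ^+ 2) * Q - 4 * N * (p * Q) - 4 * M * (q * Q) +
    (4 * N ^+ 2 + 4 * M ^+ 2 - 2) * Q by ring.
  rewrite pqQ pE qE -QE => <-; ring.
- exists (2 * k), 2, (- 2), 0; split; first by rewrite orbT.
  rewrite /conic /= !(intrN, intrM) /= -E.
  have -> : 2%:~R * p * (x ^+ 2 + y ^+ 2) = p * Q by rewrite -QE; ring.
  by rewrite pE; ring.
- exists (2 * k), 2, 2, 0; split; first by rewrite orbT.
  rewrite /conic /= !(intrN, intrM) /= -E.
  have -> : 2%:~R * q * (x ^+ 2 + y ^+ 2) = q * Q by rewrite -QE; ring.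
  by rewrite qE; ring.
Qed.

(** In these coordinates -1/z is the inversion of power 2 followed by (x, y) -> (-y, -x). The origin
    has power 4 - 2 = 2 for the circles about (2, 0), (-2, 0), (0, 2), (0, -2), so inversion
    preserves their disks and the reflection permutes them. The circles of L1, through the origin,
    become the sides of the square, and the half-planes become disks. *)
Lemma inOmega_oppinv (p q s t r l : R) : 0 < r -> 0 < l ->
  r * (p ^+ 2 + q ^+ 2) = 2 -> l * (s ^+ 2 + t ^+ 2) = 2 ->
  inOmega (- (r * q)) (- (r * p)) (- (l * t)) (- (l * s)) <->
  inJOmega p q s t.
Proof.
move=> r0 l0 rE lE; rewrite /inOmega /inJOmega /inL1.
have e1 : ((- (r * q)) ^+ 2 + (- (r * p)) ^+ 2 <= 2) = (2 <= p ^+ 2 + q ^+ 2).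
  rewrite -(ler_pM2l r0 2) rE.
  have -> : (- (r * q)) ^+ 2 + (- (r * p)) ^+ 2 = r * (r * (p ^+ 2 + q ^+ 2)).
    by ring.
  by rewrite rE.
have e2 : (- (l * t)) ^+ 2 + (- (l * s)) ^+ 2 = l * 2.
  by rewrite -lE; ring.
have hL x : (2 * `|- (l * x)| <= l * 2) = (`|x| <= 1).
  rewrite normrN normrM (gtr0_norm l0) -(ler_pM2l l0 `|x|).
  by apply/idP/idP; lra.
have hr x : (r * x + 2 <= 2) = (x <= 0).
  by rewrite -(pmulr_rle0 _ r0); apply/idP/idP; lra.
have c1 : ((- (r * q) - 2) ^+ 2 + (- (r * p)) ^+ 2 <= 2) =
    (p ^+ 2 + (q + 2) ^+ 2 <= 2).
  rewrite [X in (X <= _) = _](_ : _ = r * (p ^+ 2 + q ^+ 2 + 4 * q + 2) + 2) ?hr.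
    by apply/idP/idP; lra.
  transitivity (r * (r * (p ^+ 2 + q ^+ 2)) + 4 * r * q + 4); first by ring.
  by rewrite rE; move: rE; lra.
have c2 : ((- (r * q) + 2) ^+ 2 + (- (r * p)) ^+ 2 <= 2) =
    (p ^+ 2 + (q - 2) ^+ 2 <= 2).
  rewrite [X in (X <= _) = _](_ : _ = r * (p ^+ 2 + q ^+ 2 - 4 * q + 2) + 2) ?hr.
    by apply/idP/idP; lra.
  transitivity (r * (r * (p ^+ 2 + q ^+ 2)) - 4 * r * q + 4); first by ring.
  by rewrite rE; move: rE; lra.
have c3 : ((- (r * q)) ^+ 2 + (- (r * p) - 2) ^+ 2 <= 2) =
    ((p + 2) ^+ 2 + q ^+ 2 <= 2).
  rewrite [X in (X <= _) = _](_ : _ = r * (p ^+ 2 + q ^+ 2 + 4 * p + 2) + 2) ?hr.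
    by apply/idP/idP; lra.
  transitivity (r * (r * (p ^+ 2 + q ^+ 2)) + 4 * r * p + 4); first by ring.
  by rewrite rE; move: rE; lra.
have c4 : ((- (r * q)) ^+ 2 + (- (r * p) + 2) ^+ 2 <= 2) =
    ((p - 2) ^+ 2 + q ^+ 2 <= 2).
  rewrite [X in (X <= _) = _](_ : _ = r * (p ^+ 2 + q ^+ 2 - 4 * p + 2) + 2) ?hr.
    by apply/idP/idP; lra.
  transitivity (r * (r * (p ^+ 2 + q ^+ 2)) - 4 * r * p + 4); first by ring.
  by rewrite rE; move: rE; lra.
have hs x : (- (l * x) <= 1) = (- (2 * x) <= s ^+ 2 + t ^+ 2).
  by rewrite -(ler_pM2l l0 (- (2 * x))) lE; apply/idP/idP; lra.
have hs' x : (-1 <= - (l * x)) = (2 * x <= s ^+ 2 + t ^+ 2).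
  by rewrite -(ler_pM2l l0 (2 * x)) lE; apply/idP/idP; lra.
rewrite e1 e2 !hL c1 c2 c3 c4 !hs !hs'.
by split=> [[? [? ?] [? ?] ? ?]|[? [? ?] [? ?] ? ?]].
Qed.

Definition genericC u := generic (sumc u) (difc u).

Lemma oppinvK u : - (- u^-1)^-1 = u.
Proof. by rewrite invrN invrK opprK. Qed.

Lemma genericC_neq0 u : genericC u -> u != 0.
Proof. by apply: contraPneq => -> [_ /(_ 0)[+ _]]; rewrite /sumc addr0. Qed.

Lemma genericC_offK u : genericC u -> offK u.
Proof.
move=> [gen _]; split=> E.
- by apply: (gen 1 0); rewrite mulr1z mulr0 -[RHS]E; ring.
- by apply: (gen (-1) 0); rewrite intrN mulr1z mulr0 -[RHS]E; ring.
- by apply: (gen 0 1); rewrite mulr1z mulr0 -[RHS]E; ring.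
- by apply: (gen 0 (-1)); rewrite intrN mulr1z mulr0 -[RHS]E; ring.
Qed.

Lemma genericC_sqnorm_gt0 u : genericC u -> 0 < sumc u ^+ 2 + difc u ^+ 2.
Proof.
move=> [_ /(_ 0)[S0 _]]; apply: ltr_wpDr; first exact: sqr_ge0.
by rewrite exprn_even_gt0 //; apply/eqP.
Qed.

(** The map u -> -1/u permutes the four circles of [offK]. *)
Lemma genericC_offK_oppinv u : genericC u -> offK (- u^-1).
Proof.
move=> gu; have := genericC_sqnorm_gt0 gu; have := genericC_offK gu.
rewrite /offK sumc_oppinv difc_oppinv; move: (sumc u) (difc u) => p q [g1 g2 g3 g4] N0.
set r := 2 / (p ^+ 2 + q ^+ 2).
have r0 : r != 0 by rewrite mulf_neq0 ?invr_eq0 ?gt_eqF.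
have rE : r * (p ^+ 2 + q ^+ 2) = 2 by rewrite mulfVK // gt_eqF.
have rA x : 2 * x / (p ^+ 2 + q ^+ 2) = r * x by rewrite mulrAC.
rewrite !rA.
have key x y : r * (r * (p ^+ 2 + q ^+ 2)) + 4 * r * x + 4 = 2 ->
  y = p ^+ 2 + q ^+ 2 + 4 * x + 4 -> y = 2.
  move=> E ->; suff : p ^+ 2 + q ^+ 2 + 4 * x + 2 = 0 by lra.
  by apply: (mulfI r0); move: E; rewrite rE mulr0; move: rE; lra.
split=> E; [case: g4; apply: (key q)|case: g3; apply: (key (- q))|
  case: g2; apply: (key p)|case: g1; apply: (key (- p))];
  by rewrite -?[RHS]E; ring.
Qed.

Lemma Omega_oppinv u v : genericC u -> genericC v ->
  Omega (- u^-1, Some (- v^-1)) <-> inJOmega (sumc u) (difc u) (sumc v) (difc v).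
Proof.
move=> gu gv; rewrite OmegaP; last exact: genericC_offK_oppinv.
rewrite -(@inOmega_oppinv _ _ _ _ (2 / (sumc u ^+ 2 + difc u ^+ 2))
  (2 / (sumc v ^+ 2 + difc v ^+ 2))) ?divr_gt0 ?genericC_sqnorm_gt0 //; last 2 first.
- by rewrite mulfVK // gt_eqF // genericC_sqnorm_gt0.
- by rewrite mulfVK // gt_eqF // genericC_sqnorm_gt0.
by rewrite !sumc_oppinv !difc_oppinv (mulrAC 2 (difc u)) (mulrAC 2 (sumc u))
  (mulrAC 2 (difc v)) (mulrAC 2 (sumc v)).
Qed.

Lemma fl_cell (fl : C -> C) (hfl : disk_algorithm fl) u : exists n m : int,
  [/\ sumc (fl u) = 2 * n%:~R, difc (fl u) = 2 * m%:~R &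
      cell n m (sumc u - 2 * n%:~R) (difc u - 2 * m%:~R)].
Proof.
have [n [m [Sa Da]]] := Vof_cell (hfl u).2.
by rewrite sumcB difcB Sa Da; exists n, m.
Qed.

Lemma Ghat_oppinv (fl : C -> C) u v : v != 0 ->
  Ghat fl (- u^-1, Some (- v^-1)) = (u - fl u, Some (v - fl u)).
Proof.
by move=> v0; rewrite /Ghat /= oppinvK oppr_eq0 invr_eq0 (negbTE v0) /= oppinvK.
Qed.

End Main.

Theorem theorem4p11 (R : realType) (fl : R[i] -> R[i])
  (hfl : disk_algorithm fl) :
  bijective_ae (@Ghat_dom R) (@Omega R) (Ghat fl).
Proof.
(* Genericity is asked of -1/z and -1/w in the source but of z and w in the target: between these
   [Ghat] is a translation by a point of E, which preserves it. Both sets leave out w = oo. *)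
pose G1 := [set p : R[i] * sphere R |
  exists u v, [/\ p = (- u^-1, Some (- v^-1)), genericC u & genericC v]].
pose G2 := [set p : R[i] * sphere R |
  exists z w, [/\ p = (z, Some w), genericC z & genericC w]].
exists (~` G1), (~` G2); rewrite !setDE !setCK; split.
- apply: null_C2_conics => z w nG.
  have [gz|/not_generic_oppinv_conic] := pselect (genericC (- z^-1)); last by left.
  right; apply: not_generic_oppinv_conic => gw; apply: nG.
  by exists (- z^-1), (- w^-1); rewrite !oppinvK.
- apply: null_C2_conics => z w nG.
  have [gz|/not_generic_conic] := pselect (genericC z); last by left.
  by right; apply: not_generic_conic => gw; apply: nG; exists z, w.
- move=> p [Op [u [v [pE gu gv]]]]; rewrite pE in Op *.
  have [le2 _ _ _ _] := iffLR (OmegaP _ (genericC_offK_oppinv gu)) Op; split.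
    by rewrite /disk /= norm_le1.
  by rewrite /= oppr_eq0 invr_eq0 genericC_neq0.
split.
- move=> p [+ [u [v [pE gu gv]]]]; rewrite {}pE.
  rewrite Omega_oppinv // Ghat_oppinv ?genericC_neq0 // => Juv.
  have [n [m [Sa Da c]]] := fl_cell hfl u.
  have gu' : genericC (u - fl u)
    by rewrite /genericC sumcB difcB Sa Da; exact: generic_shift.
  have gv' : genericC (v - fl u)
    by rewrite /genericC sumcB difcB Sa Da; exact: generic_shift.
  split; last by exists (u - fl u), (v - fl u).
  apply/OmegaP; first exact: genericC_offK.
  by rewrite !sumcB !difcB Sa Da; apply: inJOmega_map.
- move=> p q /set_mem[+ [u [v [pE gu gv]]]] /set_mem[+ [u' [v' [qE gu' gv']]]].
  rewrite {}pE {}qE !Omega_oppinv // !Ghat_oppinv ?genericC_neq0 // => Juv Juv' [Eu Ev].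
  have [n [m [Sa Da _]]] := fl_cell hfl u.
  have [n' [m' [Sa' Da' _]]] := fl_cell hfl u'.
  have [_ gen] : genericC (v - fl u)
    by rewrite /genericC sumcB difcB Sa Da; exact: generic_shift.
  have [_ [Sv Dv] _ _ _] := Juv; have [_ [Sv' Dv'] _ _ _] := Juv'.
  (* Both v and v' lie in the square, so -[fl u] and -[fl u'] are both centres of the tile
     containing the common image v - [fl u]. *)
  have Ea : fl u = fl u'.
    apply: sumc_difc_inj; rewrite ?Sa ?Sa' ?Da ?Da'; congr (2 * _%:~R); apply: oppr_inj.
      apply: (tile_uniq (fun k => (gen k).1)).
        by rewrite sumcB Sa intrN mulrN opprK subrK.
      by rewrite Ev sumcB Sa' intrN mulrN opprK subrK.
    apply: (tile_uniq (fun k => (gen k).2)).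
      by rewrite difcB Da intrN mulrN opprK subrK.
    by rewrite Ev difcB Da' intrN mulrN opprK subrK.
  by move: Eu Ev; rewrite Ea => /addIr -> /addIr ->.
- move=> p [Op [z [w [pE gz gw]]]]; rewrite {}pE in Op *.
  have Ozw := iffLR (OmegaP _ (genericC_offK gz)) Op.
  have [n sn] := tile_exists (sumc w); have [m tm] := tile_exists (difc w).
  (* Minus the centre of the tile containing w: the point with [sumc] -2n and [difc] -2m. *)
  pose a : R[i] := Complex (- (n + m)%:~R) ((m - n)%:~R).
  have Sa : sumc a = 2 * (- n)%:~R by rewrite /sumc /= intrD intrB intrN; ring.
  have Da : difc a = 2 * (- m)%:~R by rewrite /difc /= intrD intrB intrN; ring.
  have gu : genericC (z + a).
    by apply: (@generic_unshift _ (- n) (- m)); rewrite -Sa -Da -sumcB -difcB addrK.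
  have gv : genericC (w + a).
    by apply: (@generic_unshift _ (- n) (- m)); rewrite -Sa -Da -sumcB -difcB addrK.
  have [c Juv] : cell (- n) (- m) (sumc (z + a) - 2 * (- n)%:~R)
      (difc (z + a) - 2 * (- m)%:~R) /\
      inJOmega (sumc (z + a)) (difc (z + a)) (sumc (w + a)) (difc (w + a)).
    apply: inOmega_inv => //.
    - by rewrite sumcD Sa intrN mulrN.
    - by rewrite difcD Da intrN mulrN.
    - by rewrite -Sa -Da -!sumcB -!difcB !addrK.
  (* Whatever convention [fl] follows on boundaries, a generic point has only one cell. *)
  have fla : fl (z + a) = a.
    have [n' [m' [Sa' Da' c']]] := fl_cell hfl (z + a).
    have [En Em] := cell_uniq gu c c'.
    by apply: sumc_difc_inj; rewrite ?Sa' ?Da' -?En -?Em.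
  exists (- (z + a)^-1, Some (- (w + a)^-1)).
    by split; [apply/Omega_oppinv|exists (z + a), (w + a)].
  by rewrite Ghat_oppinv ?genericC_neq0 // fla !addrK.
Qed.
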